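(* Let $\mathcal{X}$ be a set, let $D$ be a set, and for each $d\in D$ let $J_d\in\mathcal{L}(\mathcal{X})$ be a gamble on $\mathcal{X}$. If $\mathcal{J}=\{J_d\colon d\in D\}$ is a non-empty and weakly compact subset of $\mathcal{L}(\mathcal{X})$, then $D$ contains at least one admissible decision, and even more, for every decision $e\in D$ there is an admissible decision $d\in D$ such that $J_d\ge J_e$.
   Context: A gamble on $\mathcal{X}$ is a bounded function $\mathcal{X}\to\mathbb{R}$; $\mathcal{L}(\mathcal{X})$ is the set of all gambles on $\mathcal{X}$. Elements of $D$ are called decisions and $J_d$ is the gain gamble of $d$. Inequalities between gambles are point-wise: $f\ge g$ means $f(x)\ge g(x)$ for all $x\in\mathcal{X}$. The weak topology on $\mathcal{L}(\mathcal{X})$ here means the topology of point-wise convergence: a net $f_\alpha$ converges weakly to $f$ if and only if $\lim_\alpha f_\alpha(x)=f(x)$ for all $x\in\mathcal{X}$. Weakly compact means compact in this topology. A decision $d\in D$ is admissible (in $D$) if for every $e\in D$, either $J_e\not\ge J_d$ or $J_e=J_d$. *)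

(* Defs.v *)
From HB Require Import structures.
From mathcomp Require Import all_boot all_order all_algebra.
From mathcomp Require Import all_classical all_reals all_analysis.

Set Implicit Arguments.
Unset Strict Implicit.
Unset Printing Implicit Defensive.

Import Order.TTheory GRing.Theory Num.Theory.
Import numFieldNormedType.Exports.
Local Open Scope classical_set_scope.
Local Open Scope ring_scope.

(* Being a [set_type] over [{ptws X -> R}], the type of gambles carries the
   initial topology for the inclusion into the space of all functions [X -> R]
   with the product topology: the topology of point-wise convergence, called
   weak topology here (see [gamble_cvgP]). *)
Definition gamble (X : Type) (R : realType) :=
  set_type (bounded_fun : set {ptws X -> R}).

HB.instance Definition _ (X : Type) (R : realType) :=
  Topological.copy (gamble X R)
    (set_type (bounded_fun : set {ptws X -> R})).

Definition gamble_fun (X : Type) (R : realType) (f : gamble X R) : X -> R :=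
  set_val f.
Coercion gamble_fun : gamble >-> Funclass.

Definition gamble_ge (X : Type) (R : realType) (f g : gamble X R) : Prop :=
  forall x, g x <= f x.

Definition admissible (X : Type) (R : realType) (D : Type)
    (J : D -> gamble X R) (d : D) : Prop :=
  forall e : D, ~ gamble_ge (J e) (J d) \/ J e = J d.

Lemma gambleP (X : Type) (R : realType) (f : gamble X R) :
  exists M : R, forall x, `|f x| <= M.
Proof.
have := set_valP f; rewrite /= => -[M [_ bM]].
exists (M + 1) => x; apply: (bM (M + 1)) => //.
by rewrite ltrDl.
Qed.

Lemma gamble_of_bounded (X : Type) (R : realType) (f : X -> R) (M : R) :
  (forall x, `|f x| <= M) -> exists g : gamble X R, g = f :> (X -> R).
Proof.
move=> fM; have bf : (bounded_fun : set {ptws X -> R}) f.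
  exists M; split; first exact: num_real.
  by move=> N MN x _; apply: le_trans (fM x) (ltW MN).
by exists (SigSub (mem_set bf)).
Qed.

Lemma gamble_ext (X : Type) (R : realType) (f g : gamble X R) :
  (forall x, f x = g x) -> f = g.
Proof. by move=> fg; apply: val_inj; apply/funext => x; exact: fg. Qed.

Lemma gamble_cvgP (X : Type) (R : realType) (F : set_system (gamble X R))
    (f : gamble X R) : Filter F ->
  F --> f <-> forall x : X, (fun g : gamble X R => g x) @ F --> f x.
Proof.
move=> FF; set i : gamble X R -> {ptws X -> R} := set_val; split=> [Ff x|Ff].
  have iFf : i @ F --> i f.
    exact: cvg_trans (cvg_app _ Ff) (@initial_continuous _ _ i f).
  move=> U; rewrite nbhsE => -[V [oV Vfx] VU]; apply: (filterS VU).
  have /cvg_sup iFfx := iFf.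
  apply: (iFfx x ((fun h : X -> R => h x) @^-1` V)).
  exists ((fun h : X -> R => h x) @^-1` V); split=> //.
  by exists V.
have iFf : i @ F --> i f.
  apply/cvg_sup => x U [_ [[W oW <-] Wfx] WU]; apply: (filterS WU).
  by apply: (Ff x W); exact: open_nbhs_nbhs.
move=> U [_ [[W oW <-] Wf] WU].
by apply: (filterS WU); apply: (iFf W); exact: open_nbhs_nbhs.
Qed.

(* Main.v *)
(* Zorn's lemma on the decisions dominating a given one: the up-sets of a
   nonempty chain generate a proper filter on the compact set of gain gambles,
   and any cluster point of that filter dominates the chain, because half-spaces
   [g x < a] are weakly open. *)
Require Import Defs.
From mathcomp Require Import all_boot all_order all_algebra.
From mathcomp Require Import all_classical all_reals all_analysis.
Import Order.TTheory.
Local Open Scope classical_set_scope.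

Lemma gamble_ge_refl (X : Type) (R : realType) (f : gamble X R) :
  gamble_ge f f.
Proof. by move=> x. Qed.

Lemma gamble_ge_trans (X : Type) (R : realType) (g f h : gamble X R) :
  gamble_ge f g -> gamble_ge g h -> gamble_ge f h.
Proof. by move=> fg gh x; exact: le_trans (gh x) (fg x). Qed.

Lemma gamble_ge_anti (X : Type) (R : realType) (f g : gamble X R) :
  gamble_ge f g -> gamble_ge g f -> f = g.
Proof. by move=> fg gf; apply: gamble_ext => x; apply: le_anti; rewrite gf fg. Qed.

(** Evaluation at [x] is continuous: [gamble_cvgP] is applied to the neighbourhood filter of [f],
    which converges to [f]. *)
Lemma nbhs_gamble_lt (X : Type) (R : realType) (f : gamble X R) (x : X) (a : R) :
  (f x < a)%R -> nbhs f [set g : gamble X R | (g x < a)%R].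
Proof.
move=> fxa.
have fcvg := (gamble_cvgP f (nbhs_filter f)).1 (fun U fU => fU).
exact: (fcvg x [set y | (y < a)%R] (lt_nbhsl fxa)).
Qed.

Lemma compact_chain_ub (X : Type) (R : realType) (K A : set (gamble X R)) :
  compact K -> A `<=` K -> A !=set0 -> total_on A (fun f g => gamble_ge g f) ->
  exists2 f, K f & forall g, A g -> gamble_ge f g.
Proof.
move=> cK AK A0 Atot.
(* Up-sets are cut down to [A], so that the filter they generate contains [K]. *)
pose up g := [set h | A h /\ gamble_ge h g].
have upF : ProperFilter (filter_from A up).
  apply: filter_from_proper; last first.
    by move=> g Ag; exists g; split=> //; exact: gamble_ge_refl.
  apply: filter_from_filter => // f g Af Ag.
  (* The up-set of the larger of two chain members lies in both up-sets. *)
  have [gf|fg] := Atot _ _ Af Ag; [exists g | exists f] => // h [Ah hge].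
    by split; split=> //; exact: gamble_ge_trans gf.
  by split; split=> //; exact: gamble_ge_trans fg.
have [|f [Kf clf]] := cK _ upF.
  by have [g Ag] := A0; exists g => // h [/AK].
exists f => // g Ag x; rewrite leNgt; apply/negP => fgx.
(* The half-space of values below [g x] at [x] is a neighbourhood of [f], hence meets [up g]. *)
have [|h [[_ hg] hx]] := clf (up g) _ _ (nbhs_gamble_lt _ _ _ _ _ fgx); first by exists g.
by have := hg x; rewrite leNgt hx.
Qed.

(** Distinct decisions may share a gain, so domination is only a preorder on decisions; antisymmetry
    is recovered on gambles. *)
Lemma admissible_above (R : realType) (X D : Type) (J : D -> gamble X R) (e : D) :
  compact (range J) ->
  exists d : D, admissible J d /\ gamble_ge (J d) (J e).
Proof.
move=> cJ.
pose T := {d : D | gamble_ge (J d) (J e)}.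
pose Je (t : T) := J (sval t).
have [| | |[d de] dmax] := @ZL_preorder T (exist _ e (gamble_ge_refl _ _ (J e)))
    (fun s t => `[< gamble_ge (Je t) (Je s) >]).
- by move=> t; apply/asboolP; exact: gamble_ge_refl.
- move=> s t u /asboolP st /asboolP us; apply/asboolP.
  exact: gamble_ge_trans us st.
- move=> A Atot.
  (* The empty chain is bounded by [e] itself. *)
  have [[t0 At0]|A0] := pselect (A !=set0); last first.
    exists (exist _ e (gamble_ge_refl _ _ (J e))) => s As.
    by case: A0; exists s.
  have [||| _ [d _ <-] dub] := @compact_chain_ub _ _ _ (Je @` A) cJ.
  + by move=> _ [t _ <-]; exists (sval t).
  + by exists (Je t0), t0.
  + move=> _ _ [s As <-] [t At <-].
    by have [/asboolP|/asboolP] := Atot _ _ As At; [left | right].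
  (* The bound stays above [J e] because it dominates the chain member [t0]. *)
  have de : gamble_ge (J d) (J e).
    by apply: gamble_ge_trans (svalP t0); apply: dub; exists t0.
  by exists (exist _ d de) => s As; apply/asboolP; apply: dub; exists s.
exists d; split=> // d'.
have [d'd|] := pselect (gamble_ge (J d') (J d)); [right | by left].
apply: gamble_ge_anti => //.
(* By transitivity [d'] belongs to [T], where [d] is maximal. *)
have d'e := gamble_ge_trans _ _ _ _ _ d'd de.
by have /asboolP := dmax (exist _ d' d'e) (asboolT d'd).
Qed.

Theorem theorem3 (R : realType) (X D : Type) (J : D -> gamble X R)
    (J_nonempty : range J !=set0) (J_compact : compact (range J)) :
  (exists d : D, admissible J d) /\
  (forall e : D, exists d : D, admissible J d /\ gamble_ge (J d) (J e)).
Proof.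
split=> [|e]; last exact: admissible_above.
have [_ [e _ _]] := J_nonempty.
by have [d [dadm _]] := admissible_above _ _ _ _ e J_compact; exists d.
Qed.
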